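(* Let $m\ge1$ and let $\zeta_m$ be a primitive $m$th root of unity. The real cyclotomic unit $\zeta_m+\zeta_m^{-1}$ has arboreal height $\le 2$ only if $m\in\{1,2,3,4,5,6,8,10,12,16,20,24\}$.
   Context: An algebraic integer is totally real if all roots of its minimal polynomial over $\mathbb{Q}$ are real. The eigenvalues of a graph are those of its adjacency matrix; a rooted tree has height $h$ if the maximum distance from the root to a vertex is $h$. The arboreal height of a totally real algebraic integer $\lambda$ is the least $h$ such that some rooted tree of height $h$ has $\lambda$ as an eigenvalue. *)

(* Defs.v *)
From HB Require Import structures.
From mathcomp Require Import all_boot all_order all_algebra all_field.

Set Implicit Arguments.
Unset Strict Implicit.
Unset Printing Implicit Defensive.

Import Order.TTheory GRing.Theory Num.Theory.
Local Open Scope ring_scope.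

Definition simple_graph (T : finType) (e : rel T) : Prop :=
  symmetric e /\ irreflexive e.

Definition connected_graph (T : finType) (e : rel T) : Prop :=
  forall x y : T, connect e x y.

(* [ucycle e [:: x; y]] holds for every edge of a symmetric [e], so only
   sequences of at least three distinct vertices are cycles of the graph. *)
Definition acyclic_graph (T : finType) (e : rel T) : Prop :=
  forall c : seq T, ucycle e c -> (size c < 3)%N.

Definition is_tree (T : finType) (e : rel T) : Prop :=
  [/\ simple_graph e, connected_graph e & acyclic_graph e].

Definition has_walk (T : finType) (e : rel T) (x y : T) (n : nat) : bool :=
  [exists p : n.-tuple T, path e x p && (last x p == y)].

(* A shortest walk has fewer than [#|T|] edges, so the bound on [n] loses
   nothing; the default value [#|T|] only occurs for disconnected vertices. *)
Definition gdist (T : finType) (e : rel T) (x y : T) : nat :=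
  \big[minn/#|T|]_(n < #|T| | has_walk e x y n) n.

Definition height (T : finType) (e : rel T) (r : T) : nat :=
  \max_(v : T) gdist e r v.

Definition adjmx (T : finType) (e : rel T) : 'M[algC]_#|T| :=
  \matrix_(i, j) (e (enum_val i) (enum_val j))%:R.

Definition tree_eigenvalue_of_height (lambda : algC) (h : nat) : Prop :=
  exists (T : finType) (e : rel T) (r : T),
    [/\ is_tree e, height e r = h & eigenvalue (adjmx e) lambda].

(* The relation "[lambda] has arboreal height [h]".  It is not restricted to
   totally real algebraic integers explicitly: adjacency matrices are integral
   and symmetric, so no other [lambda] is related to any [h]. *)
Definition arboreal_height (lambda : algC) (h : nat) : Prop :=
  tree_eigenvalue_of_height lambda h /\
  forall k : nat, tree_eigenvalue_of_height lambda k -> (h <= k)%N.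

(* Main.v *)
(* Put xi = zeta^2, of order n, and mu = lambda^2 = xi + 2 + xi^-1.  In a rooted
   tree of height at most 2 whose root has children with k_i leaves each, the
   eigenvalue equations say that mu is some k_i, unless sum_i 1/(mu - k_i) = 1.
   In the first case xi is quadratic.  In the second, multiply by xi and set
   Q_k = (X + 1)^2 - k X, so that xi (mu - k) = Q_k(xi), and reduce modulo a
   prime l: Q_k depends on k mod l only.  If Phi_n is prime to every Q_k modulo l,
   then clearing denominators gives Phi_n | W - X U modulo l, where W is the
   product of the l quadratics Q_c and deg(X U) < deg W, hence totient n <= 2 l.
   The roots of the Q_k are cube roots of unity for l = 2 and fourth roots of
   unity for l = 3, so coprimality only fails when the prime-to-l part of n
   divides 3, respectively 4; the two primes together leave nine values of n. *)
Require Import Defs.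
From HB Require Import structures.
From mathcomp Require Import all_boot all_order all_algebra all_field.
From mathcomp Require Import ring zify.

Set Implicit Arguments.
Unset Strict Implicit.
Unset Printing Implicit Defensive.

Import Order.TTheory GRing.Theory Num.Theory.
Local Open Scope ring_scope.

(** * Cyclotomic polynomials over the integers and their roots in a field *)

(** ['Phi_n] is monic, so division with remainder works over the integers. The remainder vanishes at
    [z] and has smaller degree than the minimal polynomial ['Phi_n] of [z], so it is zero. An
    integral quotient can then be reduced modulo a prime. *)
Lemma Cyclotomic_dvd (n : nat) (z : algC) (P : {poly int}) :
  n.-primitive_root z -> root (map_poly intr P : {poly algC}) z ->
  exists S : {poly int}, P = S * 'Phi_n.
Proof.
move=> prim_z; rewrite {1}(Pdiv.RingMonic.rdivp_eq (Cyclotomic_monic n) P).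
set S := Pdiv.CommonRing.rdivp _ _; set r := Pdiv.CommonRing.rmodp _ _.
have root_Phi : (map_poly intr 'Phi_n : {poly algC}).[z] = 0.
  by rewrite (Cintr_Cyclotomic prim_z); apply/rootP; rewrite root_cyclotomic.
rewrite rootE rmorphD rmorphM /= hornerD hornerM root_Phi mulr0 add0r => rz0.
exists S; rewrite [LHS](Pdiv.RingMonic.rdivp_eq (Cyclotomic_monic n) P) -/S -/r.
suff -> : r = 0 by rewrite addr0.
apply: contraTeq isT => rN0.
have [p [minE _] /(_ (map_poly intr r))] := minCpolyP z.
rewrite -map_poly_comp /= (eq_map_poly (ratr_int _)) rootE rz0 => /esym/dvdp_leq.
rewrite map_poly_eq0_id0 ?intr_eq0 ?lead_coef_eq0 // => /(_ rN0).
have <- : size (map_poly ratr p : {poly algC}) = size p by rewrite size_map_poly.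
rewrite -minE (minCpoly_cyclotomic prim_z) size_cyclotomic -size_Cyclotomic.
rewrite size_map_inj_poly //; last exact: intr_inj.
by rewrite leqNgt Pdiv.Ring.ltn_rmodpN0 // monic_neq0 ?Cyclotomic_monic.
Qed.

(* [Phi_n] divides [1 + Y + ... + Y^(d-1)] with [Y = X^(n/d)], and this sum is
   [d] wherever [Y = 1]. *)
Lemma root_Cyclotomic_expr (K : fieldType) (n d : nat) (w : K) :
  (0 < n)%N -> (1 < d)%N -> (d %| n)%N ->
  root (map_poly intr 'Phi_n) w -> w ^+ (n %/ d) = 1 -> d%:R = 0 :> K.
Proof.
move=> n_gt0 d_gt1 d_n root_w w1.
have [z prim_z] := C_prim_root_exists n_gt0.
pose P : {poly int} := \sum_(j < d) 'X^(n %/ d) ^+ j.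
have evalP (R : comNzRingType) (x : R) :
    (map_poly intr P).[x] = \sum_(j < d) (x ^+ (n %/ d)) ^+ j.
  rewrite rmorph_sum horner_sum; apply: eq_bigr => j _.
  by rewrite /= -exprM map_polyXn hornerXn exprM.
have [|S PE] := @Cyclotomic_dvd n z P prim_z.
  rewrite rootE evalP -(inj_eq (mulfI (_ : z ^+ (n %/ d) - 1 != 0))).
    by rewrite -subrX1 -exprM divnK // prim_expr_order // subrr mulr0.
  rewrite subr_eq0 -(prim_order_dvd prim_z).
  by rewrite gtnNdvd ?ltn_Pdiv // divn_gt0 ?(dvdn_leq n_gt0) // ltnW.
have := evalP K w; rewrite PE rmorphM /= hornerM (rootP root_w) mulr0 w1.
by under eq_bigr do rewrite expr1n; rewrite sumr_const card_ord.
Qed.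

(** Let g = gcd(s, e), which is also gcd(s l^a, e). Bezout gives w^g = 1. If s did not divide e,
    then d = s/g would exceed 1 and w^(n/d) = 1 for n = s l^a, so d = 0 in K and l would divide
    s. *)
Lemma root_Cyclotomic_expr_coprime (K : fieldType) (l a s e : nat) (w : K) :
  prime l -> l \in [pchar K] -> coprime l s -> coprime l e -> (0 < s)%N ->
  root (map_poly intr 'Phi_(s * l ^ a)) w -> w ^+ e = 1 -> (s %| e)%N.
Proof.
move=> l_pr charK co_ls co_le s_gt0 root_w we1; apply: contraT => sNe.
have n_gt0 : (0 < s * l ^ a)%N by rewrite muln_gt0 s_gt0 expn_gt0 prime_gt0.
(* X^n - 1 is the product of the ['Phi_d] over the divisors d of n, one of which vanishes at w. *)
have wn1 : w ^+ (s * l ^ a) = 1.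
  apply/eqP; rewrite -subr_eq0; have := prod_Cyclotomic n_gt0.
  rewrite (bigD1_seq (s * l ^ a)%N) ?divisors_uniq ?divisors_id //=.
  move/(congr1 (map_poly (intr : int -> K)))/(congr1 (horner^~ w)).
  rewrite rmorphM /= hornerM (rootP root_w) mul0r rmorphB rmorph1 /= map_polyXn.
  by rewrite hornerD hornerN hornerXn hornerC => <-.
set g := gcdn s e.
have gd : (g * (s %/ g) = s)%N by rewrite mulnC divnK ?dvdn_gcdl.
have g_gt0 : (0 < g)%N by rewrite gcdn_gt0 s_gt0.
have d_gt1 : (1 < s %/ g)%N.
  rewrite ltn_neqAle divn_gt0 // (dvdn_leq s_gt0) ?dvdn_gcdl // andbT.
  apply: contraNneq sNe => d1; rewrite -gd -d1 muln1; exact: dvdn_gcdr.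
have ng1 : w ^+ g = 1.
  have gE : gcdn (s * l ^ a) e = g.
    by rewrite gcdnC Gauss_gcdl ?coprimeXr // 1?gcdnC // coprime_sym.
  have [k1 k2 kE _] := egcdnP e n_gt0.
  have := congr1 (GRing.exp w) kE; rewrite gE exprD (mulnC k1) (mulnC k2).
  by rewrite (exprM w (s * _)) (exprM w e) wn1 we1 !expr1n mul1r => <-.
have := @root_Cyclotomic_expr K (s * l ^ a) (s %/ g) w n_gt0 d_gt1.
have -> : (s * l ^ a = g * l ^ a * (s %/ g))%N by rewrite -{1}gd mulnAC.
rewrite dvdn_mull // mulnK ?(ltnW d_gt1) // exprM ng1 expr1n.
rewrite -mulnAC gd => /(_ isT root_w erefl) /eqP.
rewrite -(dvdn_pcharf charK) => l_d.
by move: co_ls; rewrite prime_coprime // -gd dvdn_mull.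
Qed.

(** * The quadratics Q_k and sums of their inverses *)

Definition quadp (R : comNzRingType) (k : nat) : {poly R} :=
  ('X + 1) ^+ 2 - 'X *+ k.

Lemma quadpE (R : comNzRingType) (k : nat) :
  quadp R k = 'X^2 + (2%:R - k%:R) *: 'X + 1.
Proof. by rewrite /quadp scalerBl !scaler_nat; ring. Qed.

Lemma size_quadp (R : comNzRingType) (k : nat) : size (quadp R k) = 3%N.
Proof.
rewrite quadpE -addrA size_polyDl size_polyXn // (leq_ltn_trans (size_polyD _ _)) //.
by rewrite size_poly1 gtn_max (leq_ltn_trans (size_scale_leq _ _)) ?size_polyX.
Qed.

Lemma quadp_monic (R : comNzRingType) (k : nat) : quadp R k \is monic.
Proof.
rewrite monicE /lead_coef size_quadp quadpE !coefD coefXn coefZ coefX coef1 /=.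
by rewrite mulr0 !addr0.
Qed.

Lemma map_quadp (R S : comNzRingType) (f : {rmorphism R -> S}) (k : nat) :
  map_poly f (quadp R k) = quadp S k.
Proof.
by rewrite rmorphB rmorphXn rmorphD rmorphMn rmorph1 /= map_polyX.
Qed.

Lemma horner_quadp (R : comNzRingType) (k : nat) (x : R) :
  (quadp R k).[x] = (x + 1) ^+ 2 - x *+ k.
Proof.
by rewrite /quadp hornerD hornerN horner_exp hornerMn hornerD hornerX hornerC.
Qed.

Lemma quadp_modn (R : comNzRingType) (l k : nat) :
  l \in [pchar R] -> quadp R (k %% l) = quadp R k.
Proof.
move=> charR; rewrite /quadp [in RHS](divn_eq k l) mulrnDr mulnC mulrnA.
by rewrite (mulrn_pchar (rmorph_pchar polyC charR)) mul0rn add0r.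
Qed.

(* The numerator of [\sum_(k <- ks) 1 / quadp k]. *)
Fixpoint num_sum_inv (R : comNzRingType) (ks : seq nat) : {poly R} :=
  if ks is k :: ks' then
    quadp R k * num_sum_inv R ks' + \prod_(i <- ks') quadp R i
  else 0.

Lemma map_num_sum_inv (R S : comNzRingType) (f : {rmorphism R -> S}) ks :
  map_poly f (num_sum_inv R ks) = num_sum_inv S ks.
Proof.
elim: ks => [|k ks IHks] /=; first by rewrite rmorph0.
rewrite rmorphD rmorphM rmorph_prod /= IHks map_quadp; congr (_ + _).
by apply: eq_bigr => i _; rewrite map_quadp.
Qed.

Lemma horner_num_sum_inv (F : fieldType) (ks : seq nat) (x : F) :
  all (fun k => (quadp F k).[x] != 0) ks ->
  (num_sum_inv F ks).[x] =
    (\prod_(k <- ks) quadp F k).[x] * \sum_(k <- ks) (quadp F k).[x]^-1.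
Proof.
elim: ks => [|k ks IHks] /=; first by rewrite !big_nil horner0 mulr0.
case/andP=> kN0 /IHks IH; rewrite !big_cons hornerD !hornerM IH mulrDr addrC.
by congr (_ + _); [rewrite mulrAC mulfV ?mul1r | rewrite mulrA].
Qed.

(** In terms of fractions, both sides are the product of all Q_k, times the product of the l
    quadratics Q_c, times the sum of the 1/Q_k: in characteristic l, each Q_k cancels against the
    Q_c of its residue class. *)
Lemma num_sum_inv_mod (R : comNzRingType) (l : nat) (ks : seq nat) :
  l \in [pchar R] ->
  num_sum_inv R ks * \prod_(c < l) quadp R c =
    (\prod_(k <- ks) quadp R k) *
    \sum_(k <- ks) \prod_(c < l | c != (k %% l)%N :> nat) quadp R c.
Proof.
move=> charR; have l_gt0 := prime_gt0 (pcharf_prime charR).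
elim: ks => [|k ks IHks] /=; first by rewrite !big_nil mul0r mulr0.
rewrite !big_cons mulrDl -mulrA IHks mulrDr addrC mulrA; congr (_ + _).
by rewrite (bigD1 (Ordinal (ltn_pmod k l_gt0))) //= quadp_modn // mulrCA mulrA.
Qed.

(** * Totient bounds by reduction modulo a prime *)

Lemma sum_inv_totient_le (l n : nat) (xi : algC) (ks : seq nat) :
  prime l -> n.-primitive_root xi ->
  (forall c, coprimep (map_poly intr 'Phi_n : {poly 'F_l}) (quadp _ c)) ->
  all (fun k => (quadp algC k).[xi] != 0) ks ->
  xi * \sum_(k <- ks) (quadp algC k).[xi]^-1 = 1 ->
  (totient n <= l.*2)%N.
Proof.
move=> l_pr prim_xi coP ksN0 sum1; have charF := pchar_Fp l_pr.
(* The equation with denominators cleared, over every ring at once: it vanishes at xi over [algC],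
   is divided by ['Phi_n] over the integers, and is then read in ['F_l]. *)
pose P R := \prod_(k <- ks) quadp R k - 'X * num_sum_inv R ks.
have mapP (R S : comNzRingType) (f : {rmorphism R -> S}) : map_poly f (P R) = P S.
  rewrite rmorphB rmorphM rmorph_prod /= map_polyX map_num_sum_inv.
  by congr (_ - _); apply: eq_bigr => k _; rewrite map_quadp.
have [|S PE] := @Cyclotomic_dvd n xi (P int) prim_xi.
  rewrite mapP rootE hornerD hornerN hornerM hornerX horner_num_sum_inv //.
  by rewrite mulrCA sum1 mulr1 subrr.
set Phi := map_poly intr _ in coP.
pose W := \prod_(c < l) quadp 'F_l c.
pose U := \sum_(k <- ks) \prod_(c < l | c != (k %% l)%N :> nat) quadp 'F_l c.
have dvdW : Phi %| W - 'X * U.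
  (* [Phi] is prime to the product of the Q_k, so W - X U may be multiplied by it; the result is
     [P 'F_l * W], and [Phi] divides [P 'F_l]. *)
  rewrite -(@Gauss_dvdpr _ _ (\prod_(k <- ks) quadp 'F_l k)); last first.
    by elim/big_rec: _ => [|k p _ co]; rewrite ?coprimep1 // coprimepMr coP.
  have -> : (\prod_(k <- ks) quadp 'F_l k) * (W - 'X * U) = P 'F_l * W.
    by rewrite mulrBl mulrBr -[in RHS]mulrA num_sum_inv_mod // mulrCA.
  by rewrite -(mapP _ _ intr) PE rmorphM /= dvdp_mulr // dvdp_mull.
have size_prod (A : pred 'I_l) :
    size (\prod_(c < l | A c) quadp 'F_l c) = (#|A|.*2).+1.
  rewrite size_prod => [|c _]; last exact/monic_neq0/quadp_monic.
  under eq_bigr do rewrite size_quadp.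
  by rewrite sum_nat_const; move: #|_| => c; rewrite -muln2; lia.
have sizeW : size W = l.*2.+1 by rewrite size_prod card_ord.
(* Each summand of U omits one of the l quadratics, so X U has degree at most 2 l - 1, and W - X U
   keeps the degree 2 l of W; in particular it is nonzero. *)
have sizeU : (size ('X * U)%R < size W)%N.
  rewrite sizeW ltnS (leq_trans (size_mul_leq _ _)) // size_polyX add2n /=.
  have l_gt0 := prime_gt0 l_pr; rewrite /U; elim/big_ind: _ => [|p q lp lq|k _].
  - by rewrite size_poly0 double_gt0.
  - by rewrite (leq_ltn_trans (size_polyD _ _)) // gtn_max lp.
  rewrite size_prod (eq_card (_ : _ =i predC1 (Ordinal (ltn_pmod k l_gt0)))) //.
  by rewrite cardC1 card_ord; lia.
have sizeWU : size (W - 'X * U) = l.*2.+1 by rewrite size_polyDl ?size_polyN.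
have := dvdp_leq _ dvdW; rewrite -size_poly_eq0 sizeWU => /(_ isT).
by rewrite /Phi size_map_poly_id0 ?size_Cyclotomic // (monicP (Cyclotomic_monic n)) oner_eq0.
Qed.

(** Over an algebraic closure of ['F_l], failure of coprimality gives a common root w; then w^e = 1
    forces s to divide e. *)
Lemma coprimep_Phi_quadp (l a s e c : nat) :
  prime l -> coprime l s -> coprime l e -> (0 < s)%N -> ~~ (s %| e)%N ->
  (forall (K : fieldType) (w : K),
     l \in [pchar K] -> root (quadp K c) w -> w ^+ e = 1) ->
  coprimep (map_poly intr 'Phi_(s * l ^ a) : {poly 'F_l}) (quadp _ c).
Proof.
move=> l_pr co_ls co_le s_gt0 sNe root1.
have [K [f _]] := countable_algebraic_closure 'F_l.
have charK : l \in [pchar K] by rewrite (fmorph_pchar f) pchar_Fp.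
rewrite -(coprimep_map f) map_quadp -map_poly_comp (eq_map_poly (rmorph_int f)).
apply: Pdiv.ClosedField.root_coprimep => w root_w; apply: contra sNe => root_q.
exact: root_Cyclotomic_expr_coprime l_pr charK co_ls co_le s_gt0 root_w
  (root1 K w charK root_q).
Qed.

(** Modulo 2, Q_0 = (X + 1)^2 and Q_1 = X^2 + X + 1. *)
Lemma root_quadp_pchar2 (K : fieldType) (c : nat) (w : K) :
  2 \in [pchar K] -> root (quadp K c) w -> w ^+ 3 = 1.
Proof.
move=> charK; rewrite -(quadp_modn c charK) rootE horner_quadp => /eqP.
have two0 : 2%:R = 0 :> K := pcharf0 charK.
have : (c %% 2 < 2)%N by rewrite ltn_mod.
case: (c %% 2)%N => [|[|//]] _ E.
  move/eqP: E; rewrite mulr0n subr0 sqrf_eq0 addr_eq0 => /eqP ->.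
  by apply/eqP; rewrite -subr_eq0; apply/eqP; transitivity (- 2%:R : K);
    [ring | rewrite two0 oppr0].
apply/eqP; rewrite -subr_eq0; apply/eqP.
by transitivity ((w - 1) * ((w + 1) ^+ 2 - w *+ 1)); [ring | rewrite E mulr0].
Qed.

(** Modulo 3, Q_0 = (X + 1)^2, Q_1 = (X - 1)^2 and Q_2 = X^2 + 1. *)
Lemma root_quadp_pchar3 (K : fieldType) (c : nat) (w : K) :
  3 \in [pchar K] -> root (quadp K c) w -> w ^+ 4 = 1.
Proof.
move=> charK; rewrite -(quadp_modn c charK) rootE horner_quadp => /eqP.
have three0 : 3%:R = 0 :> K := pcharf0 charK.
have : (c %% 3 < 3)%N by rewrite ltn_mod.
case: (c %% 3)%N => [|[|[|//]]] _ E.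
- move/eqP: E; rewrite mulr0n subr0 sqrf_eq0 addr_eq0 => /eqP ->; ring.
- have : (w - 1) ^+ 2 = 0.
    transitivity ((w + 1) ^+ 2 - w *+ 1 - 3%:R * w); first by ring.
    by rewrite E three0 mul0r subr0.
  by move/eqP; rewrite sqrf_eq0 subr_eq0 => /eqP ->; rewrite expr1n.
apply/eqP; rewrite -subr_eq0; apply/eqP.
by transitivity ((w ^+ 2 - 1) * ((w + 1) ^+ 2 - w *+ 2)); [ring | rewrite E mulr0].
Qed.

(** * The possible orders of xi and of zeta *)

Lemma totient_pfactor_le (n p : nat) : (0 < n)%N -> prime p -> (p %| n)%N ->
  (p.-1 * p ^ (logn p n).-1 <= totient n)%N.
Proof.
move=> n_gt0 p_pr p_n; have [k co_pk {2}->] := pfactor_coprime p_pr n_gt0.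
have e_gt0 : (0 < logn p n)%N by rewrite logn_gt0 mem_primes p_pr n_gt0.
rewrite totient_coprime ?totient_pfactor //; last by rewrite coprime_sym coprimeXl.
rewrite leq_pmull // totient_gt0 lt0n; apply: contraTneq co_pk => ->.
by rewrite /coprime gcdn0 neq_ltn prime_gt1 ?orbT.
Qed.

(** These are exactly the n with totient at most 4. *)
Definition small_orders : seq nat := [:: 1; 2; 3; 4; 5; 6; 8; 10; 12]%N.

(** Each exact prime power in n has totient at most 4, so it is one of 2, 4, 8, 3, 5. Hence n
    divides 120, and the divisors of 120 are checked by computation. *)
Lemma totient_le4 (n : nat) :
  (0 < n)%N -> (totient n <= 4)%N -> n \in small_orders.
Proof.
move=> n_gt0 phi4.
suff n120 : (n %| 120)%N.
  have /allP/(_ n) : all (fun k => (totient k <= 4)%N ==> (k \in small_orders))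
    (divisors 120) by vm_compute.
  by rewrite -dvdn_divisors // n120 phi4 => /(_ isT).
apply/dvdn_partP => // p; rewrite mem_primes => /and3P[p_pr _ p_n].
rewrite p_part; have := leq_trans (totient_pfactor_le n_gt0 p_pr p_n) phi4.
have : (0 < logn p n)%N by rewrite logn_gt0 mem_primes p_pr n_gt0.
case: (logn p n) => // e _ /=.
have p_le5 : (p.-1 * p ^ e <= 4)%N -> (p <= 5)%N.
  by have : (0 < p ^ e)%N by [rewrite expn_gt0 prime_gt0]; nia.
move=> H; have {}p_le5 := p_le5 H; move: p_le5 p_pr H {p_n}.
case: p => [|[|[|[|[|[|//]]]]]] //= _ _.
- case: e => [|[|[|e]]] //; rewrite !expnS.
  have : (0 < 2 ^ e)%N by rewrite expn_gt0.
  lia.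
- case: e => [|e] //; rewrite !expnS.
  have : (0 < 3 ^ e)%N by rewrite expn_gt0.
  lia.
- case: e => [|e] //; rewrite !expnS.
  have : (0 < 5 ^ e)%N by rewrite expn_gt0.
  lia.
Qed.

(** ['Phi_n] divides a monic quadratic, so its degree [totient n] is at most 2. *)
Lemma root_quadp_order (n k : nat) (xi : algC) :
  n.-primitive_root xi -> root (quadp algC k) xi -> n \in small_orders.
Proof.
move=> prim_xi; rewrite -(map_quadp intr) => /(Cyclotomic_dvd prim_xi)[S QE].
apply: totient_le4 (prim_order_gt0 prim_xi) _.
have SN0 : S != 0.
  apply: contra_eqN QE => /eqP ->.
  by rewrite mul0r; apply/monic_neq0/quadp_monic.
have := size_quadp int k; rewrite QE size_Mmonic ?Cyclotomic_monic //.
by rewrite size_Cyclotomic; move: SN0; rewrite -size_poly_gt0; lia.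
Qed.

(** Write n = s 2^a = t 3^b with s odd and t prime to 3. Unless s divides 3, the prime 2 gives
    totient at most 4. If s divides 3 and t divides 4, then n divides 12. If only s does, the prime
    3 gives totient at most 6, so 2^a is at most 8 and n divides 24; n = 24 itself has totient 8. *)
Lemma sum_inv_order (n : nat) (xi : algC) (ks : seq nat) :
  n.-primitive_root xi -> all (fun k => (quadp algC k).[xi] != 0) ks ->
  xi * \sum_(k <- ks) (quadp algC k).[xi]^-1 = 1 ->
  n \in small_orders.
Proof.
move=> prim_xi ksN0 sum1; have n_gt0 := prim_order_gt0 prim_xi.
have [s co2s nE2] := pfactor_coprime (isT : prime 2) n_gt0.
have [t co3t nE3] := pfactor_coprime (isT : prime 3) n_gt0.
have s_gt0 : (0 < s)%N by case: s co2s {nE2}.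
have t_gt0 : (0 < t)%N by case: t co3t {nE3}.
have [s3|sN3] := boolP (s %| 3)%N; last first.
  apply: totient_le4 => //; apply: (@sum_inv_totient_le 2) sum1 => // c.
  by rewrite nE2; apply: coprimep_Phi_quadp sN3 _ => // K w; apply: root_quadp_pchar2.
have dvd_n b : (2 ^ logn 2 n %| b)%N -> (n %| 3 * b)%N.
  by move=> ab; rewrite nE2 dvdn_mul.
suff n24 : (n %| 24)%N /\ ((totient n <= 6) || (n %| 12))%N.
  have /allP/(_ n) : all (fun k => ((totient k <= 6) || (k %| 12))%N ==>
    (k \in small_orders)) (divisors 24) by vm_compute.
  by rewrite -dvdn_divisors // n24.1 n24.2 => /(_ isT).
have [t4|tN4] := boolP (t %| 4)%N.
  have n12 : (n %| 3 * 4)%N.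
    apply: dvd_n; apply: dvdn_trans t4.
    have : (2 ^ logn 2 n %| t * 3 ^ logn 3 n)%N by rewrite -nE3 pfactor_dvdnn.
    by rewrite Gauss_dvdl // coprimeXl // coprimeXr.
  by rewrite (dvdn_trans n12) // n12 orbT.
have phi6 : (totient n <= 6)%N.
  apply: (@sum_inv_totient_le 3) sum1 => // c.
  by rewrite nE3; apply: coprimep_Phi_quadp tN4 _ => // K w; apply: root_quadp_pchar3.
rewrite phi6; split=> //; apply: (dvd_n 8).
have [n2|n2] := boolP (2 %| n)%N; last by rewrite lognE (negPf n2) andbF.
have := leq_trans (totient_pfactor_le n_gt0 (isT : prime 2) n2) phi6.
case: (logn 2 n) => [|[|[|[|e]]]] //; rewrite /= !expnS.
have : (0 < 2 ^ e)%N by rewrite expn_gt0.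
lia.
Qed.

(** Either m = 2 n, or m = n with n odd, that is n in {1, 3, 5}. *)
Lemma small_orders_sqr (m : nat) (zeta : algC) (n : nat) :
  m.-primitive_root zeta -> n.-primitive_root (zeta ^+ 2) -> n \in small_orders ->
  m \in [:: 1; 2; 3; 4; 5; 6; 8; 10; 12; 16; 20; 24]%N.
Proof.
set L := [:: _ & _].
move=> prim_z prim_n; have m2 : (m %| 2 * n)%N.
  by rewrite (prim_order_dvd prim_z) exprM prim_expr_order.
have n_m : (n %| m)%N.
  by rewrite (prim_order_dvd prim_n) exprAC (prim_expr_order prim_z) expr1n eqxx.
case/dvdnP: n_m m2 prim_z => k ->; rewrite dvdn_pmul2r ?(prim_order_gt0 prim_n) //.
move=> k2; have /orP[/eqP->|/eqP->] : (k == 1)%N || (k == 2)%N.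
  by case: k k2 => [|[|[|k /dvdn_leq]]] // /(_ isT).
- rewrite mul1n => prim_z; move: prim_n; rewrite (prim_root_exp_coprime _ prim_z).
  move=> co2n nL; apply: implyP co2n.
  exact: (allP (isT : all (fun i => coprime 2 i ==> (i \in L))%N small_orders)).
by move=> _; exact: (allP (isT : all (fun i => 2 * i \in L)%N small_orders)).
Qed.

(** * Eigenvectors of rooted trees of height at most 2 *)

Lemma gdist_le2 (T : finType) (e : rel T) (r x : T) :
  connected_graph e -> (gdist e r x <= 2)%N ->
  [\/ x = r, e r x | exists2 c, e r c & e c x].
Proof.
move=> e_conn dist_x.
suff [p e_p [px size_p]] : exists2 p, path e r p & last r p = x /\ (size p <= 2)%N.
  case: p e_p px size_p => [|c [|d [|//]]] /=.
  - by move=> _ ->; constructor.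
  - by rewrite andbT => erc <-; constructor.
  - by rewrite andbT => /andP[erc ecd] <- _; constructor 3; exists c.
have [/existsP[n /existsP[p /andP[e_p /eqP px]]]|no_walk] :=
    boolP [exists n : 'I_3, has_walk e r x n].
  by exists p => //; rewrite size_tuple -ltnS ltn_ord.
suff : (3 <= gdist e r x)%N by rewrite ltnNge dist_x.
have walk_gt2 p : path e r p -> last r p = x -> (2 < size p)%N.
  move=> e_p px; rewrite ltnNge; apply: contra no_walk => p2.
  by apply/existsP; exists (Ordinal (p2 : size p < 3)%N); apply/existsP;
    exists (in_tuple p); rewrite e_p px /=.
apply: (big_ind (fun d => 3 <= d)%N) => [|a b a3 b3|n /existsP[p /andP[e_p /eqP px]]].
(* The default value [#|T|] of the minimum: a repetition-free path from r to x has more than two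
   edges, so [#|T|] exceeds 3. *)
- have /connectP[p e_p px] := e_conn r x.
  case/shortenP: e_p px => q e_q q_uniq _ qx.
  have := max_card (mem (r :: q)); rewrite (card_uniqP q_uniq) /=.
  exact/ltn_trans/walk_gt2/esym.
- by rewrite leq_min a3.
- by rewrite -(size_tuple p) walk_gt2.
Qed.

(** [eigenvalue] provides a row vector, so its equation sums over the edges into x; symmetry of e
    turns them into the edges out of x. *)
Lemma adjmx_eigenvalueP (T : finType) (e : rel T) (a : algC) :
  symmetric e -> eigenvalue (adjmx e) a ->
  exists2 f : T -> algC, (forall x, a * f x = \sum_(y | e x y) f y) &
    exists x, f x != 0.
Proof.
move=> e_sym /eigenvalueP[v vA vN0]; exists (fun x => v 0 (enum_rank x)).
  move=> x; have /matrixP/(_ 0 (enum_rank x)) := vA; rewrite !mxE => <-.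
  rewrite (reindex (@enum_val T predT)) /=; last exact/onW_bij/enum_val_bij.
  rewrite [in RHS]big_mkcond; apply: eq_bigr => i _.
  by rewrite !mxE enum_rankK enum_valK e_sym; case: ifP; rewrite ?mulr1 ?mulr0.
apply/existsP; apply: contraNT vN0; rewrite negb_exists => /forallP v0.
apply/eqP/matrixP => i j; rewrite ord1 mxE -(enum_valK j).
exact/eqP/negPn/v0.
Qed.

(** For an eigenvector f, a leaf w below a child c of the root gives lambda f(w) = f(c). The
    equation at c becomes (lambda^2 - k_c) f(c) = lambda f(r). If no factor vanishes, solve for
    f(c), sum over c to get lambda f(r), and cancel. *)
Lemma tree_height_le2_sum (lambda : algC) (h : nat) :
  lambda != 0 -> (h <= 2)%N -> tree_eigenvalue_of_height lambda h ->
  (exists k : nat, lambda ^+ 2 = k%:R) \/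
  exists2 ks : seq nat, all (fun k => lambda ^+ 2 != k%:R) ks &
    \sum_(k <- ks) (lambda ^+ 2 - k%:R)^-1 = 1.
Proof.
move=> lN0 h2 [T [e [r [[[e_sym e_irr] e_conn e_acyc] ht /(adjmx_eigenvalueP e_sym)]]]].
case=> f fE [x0 fx0].
have near x : [\/ x = r, e r x | exists2 c, e r c & e c x].
  apply: gdist_le2 e_conn _; apply: leq_trans h2; rewrite -ht.
  exact: (leq_bigmax x).
have eN x y : e x y -> x != y by apply: contraTneq => ->; rewrite e_irr.
have no_cycle c : cycle e c -> uniq c -> (2 < size c)%N -> False.
  by move=> cyc un; rewrite ltnNge -ltnS; apply/negP; rewrite negbK e_acyc // /ucycle cyc.
have children_indep c d : e r c -> e r d -> ~~ e c d.
  move=> rc rd; apply/negP => cd; apply: (@no_cycle [:: r; c; d]) => //=.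
    by rewrite rc cd e_sym rd.
  by rewrite !inE negb_or !eN.
(* A further neighbour y of w would close a cycle: r c w y if y is a child of the root, c w y if y
   lies below c, and r c w y d if y lies below another child d. *)
have leaf_nbr c w y : e r c -> e c w -> w != r -> e w y = (y == c).
  move=> rc cw wr; apply/idP/eqP => [wy|->]; last by rewrite e_sym.
  apply/eqP; apply: contraTT isT => yc.
  have rw : ~~ e r w by apply: contraL cw => /(children_indep _ _ rc).
  have yr : y != r by apply: contraNneq rw => <-; rewrite e_sym.
  have [r_c c_w w_y] : [/\ r != c, c != w & w != y] by split; apply: eN.
  have r_w : r != w by rewrite eq_sym.
  have r_y : r != y by rewrite eq_sym.
  have c_y : c != y by rewrite eq_sym.
  case: (near y) => [/eqP|ry|[d rd dy]]; first by rewrite (negPf yr).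
    case: (@no_cycle [:: r; c; w; y]) => //=; first by rewrite rc cw wy e_sym ry.
    by rewrite !inE !negb_or r_c r_w r_y c_w c_y w_y.
  have [dc|dc] := eqVneq d c.
    case: (@no_cycle [:: c; w; y]) => //=; first by rewrite cw wy e_sym -dc dy.
    by rewrite !inE negb_or c_w c_y w_y.
  have [r_d y_d] : r != d /\ y != d by rewrite (eq_sym y) !eN.
  have w_d : w != d by apply: contraNneq rw => ->.
  have c_d : c != d by rewrite eq_sym.
  case: (@no_cycle [:: r; c; w; y; d]) => //=.
    by rewrite rc cw wy !(e_sym _ d) dy e_sym rd.
  by rewrite !inE !negb_or r_c r_w r_y r_d c_w c_y c_d w_y w_d y_d.
pose k c := #|[pred w | e c w & w != r]|.
have leafE c w : e r c -> e c w -> w != r -> lambda * f w = f c.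
  move=> rc cw wr; rewrite fE (eq_bigl (pred1 c)) ?big_pred1_eq // => y.
  exact: leaf_nbr rc cw wr.
have childE c : e r c -> (lambda ^+ 2 - (k c)%:R) * f c = lambda * f r.
  move=> rc; rewrite mulrBl expr2 -mulrA (fE c) (bigD1 r) /=; last by rewrite e_sym.
  rewrite mulrDr mulr_sumr (eq_bigr (fun=> f c)) => [|w /andP[cw wr]].
    by rewrite sumr_const mulr_natl addrK.
  exact: leafE.
have [/existsP[c /andP[rc /eqP mu_k]]|no_k] :=
    boolP [exists c, e r c && (lambda ^+ 2 == (k c)%:R)].
  by left; exists (k c).
have {}no_k c : e r c -> lambda ^+ 2 - (k c)%:R != 0.
  move=> rc; rewrite subr_eq0; apply: contraNneq no_k => mu_k.
  by apply/existsP; exists c; rewrite rc mu_k eqxx.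
have fcE c : e r c -> f c = lambda * f r * (lambda ^+ 2 - (k c)%:R)^-1.
  by move=> rc; rewrite -(childE c rc) mulrAC mulfV ?mul1r ?no_k.
(* If f(r) = 0, then f vanishes at the children, and at the leaves because lambda is nonzero, hence
   everywhere. *)
have frN0 : f r != 0.
  apply: contra_neq fx0 => fr0.
  have fc0 c : e r c -> f c = 0 by move=> rc; rewrite fcE // fr0 mulr0 mul0r.
  case: (near x0) => [->//|/fc0//|[c rc cx]].
  have [->//|xr] := eqVneq x0 r.
  by apply: (mulfI lN0); rewrite (leafE c) // fc0 ?mulr0.
right; exists [seq k c | c <- enum (e r)].
  by apply/allP => _ /mapP[c + ->]; rewrite mem_enum -subr_eq0 => /no_k.
rewrite big_map big_enum /=; apply: (mulfI (mulf_neq0 lN0 frN0)).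
by rewrite mulr1 mulr_sumr [RHS]fE; apply: eq_bigr => c /fcE ->.
Qed.

(** * From the tree equation to the list of orders *)

Theorem theorem3 (m : nat) (hm : (1 <= m)%N)
    (zeta : algC) (hzeta : m.-primitive_root zeta)
    (h : nat) (hh : arboreal_height (zeta + zeta^-1) h) (hle : (h <= 2)%N) :
  m \in [:: 1; 2; 3; 4; 5; 6; 8; 10; 12; 16; 20; 24]%N.
Proof.
have prim_xi := exp_prim_root hzeta 2.
apply: (small_orders_sqr hzeta prim_xi).
have zN0 : zeta != 0.
  apply: contra_eq_neq (prim_expr_order hzeta) => ->.
  by rewrite expr0n eqn0Ngt hm eq_sym oner_neq0.
have quadp_xi k : (quadp algC k).[zeta ^+ 2] =
    zeta ^+ 2 * ((zeta + zeta^-1) ^+ 2 - k%:R).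
  by rewrite horner_quadp; field.
(* [m %/ gcdn 2 m] is the order of zeta^2. *)
have root_order k : (zeta + zeta^-1) ^+ 2 = k%:R ->
    (m %/ gcdn 2 m)%N \in small_orders.
  move=> lk; apply: (root_quadp_order (k := k) prim_xi).
  by rewrite rootE quadp_xi lk subrr mulr0.
(* A zero eigenvalue falls under the case mu = k with k = 0. *)
have [l0|lN0] := eqVneq (zeta + zeta^-1) 0.
  by apply: (root_order 0%N); rewrite l0 expr0n.
have [[k /root_order//]|[ks ksN0 sum1]] := tree_height_le2_sum lN0 hle hh.1.
apply: (sum_inv_order prim_xi (ks := ks)).
  by apply: sub_all ksN0 => k kN0; rewrite quadp_xi mulf_neq0 ?expf_neq0 // subr_eq0.
rewrite -[RHS]sum1 mulr_sumr; apply: eq_bigr => k _.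
by rewrite quadp_xi invfM mulVKf ?expf_neq0.
Qed.
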